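(* Let $U=SC$ be the time evolution operator of the extended coined-Szegedy quantum walk on the half line (with a self loop at the origin), and let $P$ be the transition operator of its underlying random walk on $\mathbb{Z}_+=\{0,1,2,\dots\}$. If the underlying random walk is not null recurrent (that is, it is either positive recurrent or transient), then $U$ has point spectrum, i.e. $U$ has at least one eigenvalue with a nonzero eigenvector in $\ell^2(A)$.
   Context: Graph: the half line with vertex set $\mathbb{Z}_+$, edges $\{j,j+1\}$ $(j\ge 0)$, and one self loop at $0$. The arc set $A$ consists of, for each $j\ge 0$, the arc $(j;R)$ with terminus $j$ and origin $j+1$, the arc $(j+1;L)$ with terminus $j+1$ and origin $j$, and the self loop $(0;L)$ with origin and terminus $0$. The inverse arc $\bar a$ is given by $\overline{(j;R)}=(j+1;L)$, $\overline{(j+1;L)}=(j;R)$, $\overline{(0;L)}=(0;L)$. The shift $S$ on $\ell^2(A)$ is $(S\psi)(a)=\psi(\bar a)$. Coin: let $\mathcal{A}_j=\{\psi\in\ell^2(A): \psi(a)=0 \text{ unless } a\in\{(j;R),(j;L)\}\}\cong\mathbb{C}^2$, so that $\ell^2(A)=\bigoplus_{j\ge 0}\mathcal{A}_j$. The coin is $C=\bigoplus_{j\ge0}C_j$, where each $C_j$ is a unitary operator on $\mathcal{A}_j$, and there are two distinct unimodular numbers $e^{i\sigma_1}\ne e^{i\sigma_2}$, independent of $j$, such that $\mathrm{Spec}(C_j)=\{e^{i\sigma_1},e^{i\sigma_2}\}$ and $\dim\ker(e^{i\sigma_1}-C_j)=1$ for every $j$. The quantum walk is $U=SC$. Underlying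 random walk: let $\alpha_j\in\mathcal{A}_j$ be a unit vector spanning $\ker(e^{i\sigma_1}-C_j)$, and put $p_j=|\alpha_j(j;R)|^2$, $q_j=|\alpha_j(j;L)|^2$, so $p_j+q_j=1$. It is assumed that $p_j,q_j>0$ for all $j\ge 0$. The underlying random walk is the Markov chain on $\mathbb{Z}_+$ that from $j\ge1$ moves to $j+1$ with probability $p_j$ and to $j-1$ with probability $q_j$, and from $0$ moves to $1$ with probability $p_0$ and stays at $0$ with probability $q_0$; $P$ is its transition operator. With $T_j$ the return time to $j$ of the chain started at $j$: the walk is positive recurrent if $\mathbb{P}(T_j<\infty)=1$ and $\mathbb{E}(T_j)<\infty$; null recurrent if $\mathbb{P}(T_j<\infty)=1$ and $\mathbb{E}(T_j)=\infty$; transient if $\mathbb{P}(T_j<\infty)<1$. *)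

(* Defs.v *)
From HB Require Import structures.
From mathcomp Require Import all_boot all_order all_algebra.
From mathcomp Require Import complex.
From mathcomp Require Import all_classical all_reals all_analysis.

Set Implicit Arguments.
Unset Strict Implicit.
Unset Printing Implicit Defensive.

Import Order.TTheory GRing.Theory Num.Theory.
Import numFieldNormedType.Exports.

Local Open Scope classical_set_scope.
Local Open Scope ring_scope.
Local Open Scope complex_scope.

(* An arc (j, d) has terminus j.  The label d is an index into 'I_2, so that
   the fibre of amplitudes over a vertex j is 'rV_2:
   (j, dR) has origin j+1, (j+1, dL) has origin j, (0, dL) is the self loop. *)
Definition arc : Type := (nat * 'I_2)%type.
Definition dR : 'I_2 := ord0.
Definition dL : 'I_2 := ord_max.

Definition arc_inv (a : arc) : arc :=
  if a.2 == dR then (a.1.+1, dL)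
  else if a.1 is j.+1 then (j, dR) else (0%N, dL).

Section QuantumWalk.
Variable R : realType.

Definition sqmod (z : R[i]) : R := Normc.normc z ^+ 2.

Definition ell2 (psi : arc -> R[i]) : Prop :=
  (\esum_(a in [set: arc]) (sqmod (psi a))%:E < +oo)%E.

Definition fibre (psi : arc -> R[i]) (j : nat) : 'rV[R[i]]_2 :=
  \row_d psi (j, d).

Definition shift_op (psi : arc -> R[i]) : arc -> R[i] :=
  fun a => psi (arc_inv a).

(* The j-th block of the coin is given by its matrix acting on row vectors
   from the right, as in the library's [eigenvalue] and [eigenspace]. *)
Definition coin_op (C : nat -> 'M[R[i]]_2) (psi : arc -> R[i]) : arc -> R[i] :=
  fun a => (fibre psi a.1 *m C a.1) 0 a.2.

Definition walk_op (C : nat -> 'M[R[i]]_2) (psi : arc -> R[i]) : arc -> R[i] :=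
  shift_op (coin_op C psi).

Definition point_spectrum (U : (arc -> R[i]) -> arc -> R[i]) : set R[i] :=
  [set z | exists psi : arc -> R[i],
     [/\ ell2 psi, exists a, psi a != 0 & forall a, U psi a = z * psi a]].

End QuantumWalk.

Section RandomWalk.
Variable R : realType.

(* For i = 0 the second branch reads k = 0 and is the self loop. *)
Definition transition (p q : nat -> R) (i k : nat) : R :=
  if k == i.+1 then p i else if k == i.-1 then q i else 0.

Variables (d : measure_display) (T : measurableType d).

Definition cylinder (X : nat -> T -> nat) (n : nat) (x : nat -> nat) : set T :=
  [set w | forall k, (k <= n)%N -> X k w = x k].

(* Under Pr j, the process X is a Markov chain started at j with transition
   matrix M; the Markov property is written without dividing by the
   probability of the past. *)
Definition markov_chain (M : nat -> nat -> R) (Pr : nat -> probability T R)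
    (X : nat -> {mfun T >-> nat}) : Prop :=
  forall j : nat,
    Pr j [set w | X 0%N w = j] = 1%E /\
    forall (n : nat) (x : nat -> nat),
      Pr j (cylinder X n.+1 x) =
      (Pr j (cylinder X n x) * (M (x n) (x n.+1))%:E)%E.

(* +oo when X never comes back to j after time 0. *)
Definition return_time (X : nat -> T -> nat) (j : nat) (w : T) : \bar R :=
  ereal_inf [set (n%:R)%:E | n in [set n : nat | (0 < n)%N /\ X n w = j]].

Definition null_recurrent (Pr : nat -> probability T R)
    (X : nat -> T -> nat) : Prop :=
  forall j : nat,
    Pr j [set w | (return_time X j w < +oo)%E] = 1%E /\
    (\int[Pr j]_w return_time X j w = +oo)%E.

End RandomWalk.

(* Main.v *)
Require Import Defs.
From HB Require Import structures.
From mathcomp Require Import all_boot all_order all_algebra.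
From mathcomp Require Import complex.
From mathcomp Require Import all_classical all_reals all_analysis.
From mathcomp Require Import measurable_realfun.
From mathcomp Require Import zify ring lra.

Set Implicit Arguments.
Unset Strict Implicit.
Unset Printing Implicit Defensive.

Import Order.TTheory GRing.Theory Num.Theory.
Import numFieldNormedType.Exports.

Local Open Scope classical_set_scope.
Local Open Scope ring_scope.
Local Open Scope complex_scope.

(** Write c_i for the product of p_k / q_k over k < i, the conductance of the
    edge {i-1, i} of the underlying walk (of the self loop for i = 0).

    If psi is fixed by the shift and every fibre of psi lies in the eigenspace
    of C_j for the same s, then U psi = s psi.  Being fixed by the shift means
    assigning one amplitude y_i to each unoriented edge, and the eigenspace
    condition is a two-term recursion for y: it gives |y_i|^2 = c_i for
    s = s1, and |y_i|^2 = 1 / c_i for s = s2, whose eigenvector is orthogonal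
    to alpha_j.  Hence U has an eigenvector as soon as the sum of the c_i or
    the sum of the 1 / c_i converges.

    If both sums diverge, the walk is null recurrent.  Let h(i) be the
    probability of never hitting j from i, and W(i) the expected time to hit j
    from i, both set to 0 at i = j.  Above j the flow c_(i+1) (h(i+1) - h(i)) is
    constant, so a nonzero h would be unbounded because the sum of the 1 / c_i
    diverges.  Likewise c_(i+1) (W(i+1) - W(i)) drops at each step by
    c_i + c_(i+1), so if the mean return time to j
    were finite this flow would become at most -1
    and W would become negative. *)

(** For nonnegative terms this is convergence of the series. *)
Definition bounded_sums (R : realType) (a : nat -> R) : Prop :=
  exists B, forall n, \sum_(i < n) a i <= B.

Lemma bounded_sums_shift (R : realType) (a : nat -> R) (m : nat) :
  (forall i, 0 <= a i) -> bounded_sums (fun i => a (m + i)%N) -> bounded_sums a.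
Proof.
move=> a0 [B aB]; exists (\sum_(i < m) a i + B) => n.
have : \sum_(i < m + n) a i <= \sum_(i < m) a i + B.
  by rewrite big_split_ord lerD2l; exact: aB.
by apply: le_trans; rewrite addnC big_split_ord /= lerDl sumr_ge0.
Qed.

(** * Conductances of the birth-death chain *)

Section BirthDeath.
Variables (R : realType) (p q : nat -> R).
Hypotheses (p_gt0 : forall i, 0 < p i) (q_gt0 : forall i, 0 < q i).

(* The reversible measure of the walk is i |-> conductance i + conductance i.+1. *)
Definition conductance (i : nat) : R := \prod_(k < i) (p k / q k).

Lemma conductanceS i : conductance i.+1 = conductance i * (p i / q i).
Proof. by rewrite /conductance big_ord_recr. Qed.

Lemma conductance_gt0 i : 0 < conductance i.
Proof. by apply: prodr_gt0 => k _; rewrite divr_gt0. Qed.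

Lemma conductance_cross i : conductance i.+1 * q i = conductance i * p i.
Proof. by rewrite conductanceS -mulrA divfK // gt_eqF. Qed.

(** Each step from [i] lowers [v] by at least [e / conductance i.+1]. A nonnegative [v] can lose at
    most [v m] in total, so telescoping bounds the sum of the inverse conductances. *)
Lemma bounded_sums_of_descent (v : nat -> R) (m : nat) (e : R) :
  0 < e -> (forall i, (m <= i)%N -> 0 <= v i) ->
  (forall i, (m <= i)%N -> conductance i.+1 * (v i.+1 - v i) <= - e) ->
  bounded_sums (fun i => (conductance i)^-1).
Proof.
move=> e0 v0 dv; apply: (@bounded_sums_shift _ _ m.+1).
  by move=> i; rewrite invr_ge0 ltW // conductance_gt0.
exists (v m / e) => n.
suff: \sum_(i < n) (conductance (m.+1 + i))^-1 <= (v m - v (m + n)%N) / e.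
  by move/le_trans; apply; rewrite ler_pM2r ?invr_gt0 // gerBl v0 // leq_addr.
elim: n => [|n IH]; first by rewrite big_ord0 addn0 subrr mul0r.
rewrite big_ord_recr /=; apply: (le_trans (lerD IH (lexx _))).
rewrite -subr_ge0.
have := dv (m + n)%N (leq_addr _ _); rewrite addSn addnS.
set c := conductance _; have c0 : 0 < c := conductance_gt0 _.
set a := v _; set b := v (m + n)%N => H.
have -> : (v m - a) / e - ((v m - b) / e + c^-1)
   = (- e - c * (a - b)) / (c * e) by field; rewrite !gt_eqF.
by rewrite divr_ge0 ?subr_ge0 // ltW // mulr_gt0.
Qed.

(** * Taboo probabilities *)

Hypothesis pq1 : forall i, p i + q i = 1.

(* The probability, started at i, of not visiting j at times 1, ..., n. *)
Fixpoint taboo (j n i : nat) : R :=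
  if n is n'.+1 then
    p i * (if i.+1 == j then 0 else taboo j n' i.+1)
    + q i * (if i.-1 == j then 0 else taboo j n' i.-1)
  else 1.

Lemma tabooS j n i : taboo j n.+1 i =
  p i * (if i.+1 == j then 0 else taboo j n i.+1)
  + q i * (if i.-1 == j then 0 else taboo j n i.-1).
Proof. by []. Qed.

Lemma taboo_ge0 j n i : 0 <= taboo j n i.
Proof.
elim: n i => [|n IH] i //=.
by apply: addr_ge0; apply: mulr_ge0; rewrite ?(ltW (p_gt0 _)) ?(ltW (q_gt0 _)) //;
  case: ifP.
Qed.

Lemma taboo_le1 j n i : taboo j n i <= 1.
Proof.
elim: n i => [|n IH] i //=; rewrite -(pq1 i).
by apply: lerD; rewrite ger_pMr //; case: ifP.
Qed.

Lemma taboo_noninc j i : {homo (fun n => taboo j n i) : n m / (n <= m)%N >-> m <= n}.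
Proof.
apply/nonincreasing_seqP => n; elim: n i => [|n IH] i; first exact: taboo_le1.
rewrite tabooS (tabooS j n).
by apply: lerD; rewrite ler_pM2l //; case: ifP => // _; exact: IH.
Qed.

(** * Recurrence and mean return time at a fixed vertex *)

Section Excursions.
Variable j : nat.
Local Notation c := conductance.

Definition taboo_lim (i : nat) : R := limn (fun n => taboo j n i).

Lemma taboo_cvg i : (fun n => taboo j n i) @ \oo --> taboo_lim i.
Proof.
apply: nonincreasing_is_cvgn; first exact: taboo_noninc.
by exists 0 => _ [n _ <-]; exact: taboo_ge0.
Qed.

Lemma cvg_off (i : nat) (u : nat -> R) l : u n @[n --> \oo] --> l ->
  (if i == j then 0 else u n) @[n --> \oo] --> (if i == j then 0 else l).
Proof. by case: ifP => // _ _; exact: cvg_cst. Qed.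

(** Overriding the value at [j] makes time 0 count as a visit; [taboo_lim j] itself is the escape
    probability from [j]. *)
Let h (i : nat) : R := if i == j then 0 else taboo_lim i.

Lemma taboo_lim_rec i :
  taboo_lim i = p i * h i.+1 + q i * h i.-1.
Proof.
have H1 : (fun n => taboo j n.+1 i) @ \oo --> taboo_lim i.
  by have := @taboo_cvg i; rewrite -cvg_shiftS.
have H2 : (fun n => taboo j n.+1 i) @ \oo --> p i * h i.+1 + q i * h i.-1.
  by apply: cvgD; apply: cvgM; (try exact: cvg_cst); apply: cvg_off; exact: taboo_cvg.
exact: cvg_unique H1 H2.
Qed.

(** Harmonicity of [h] at a vertex other than [j] is conservation of flow there, by
    [conductance_cross]. *)
Lemma taboo_lim_flow i : i.+1 != j ->
  c i.+2 * (h i.+2 - h i.+1) = c i.+1 * (h i.+1 - h i).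
Proof.
move=> ij; have := taboo_lim_rec i.+1; rewrite /= -{1}(mul1r (taboo_lim _)) -(pq1 i.+1).
have -> : taboo_lim i.+1 = h i.+1 by rewrite /h (negbTE ij).
move=> E; have q0 := q_gt0 i.+1.
apply: (mulIf (lt0r_neq0 q0)); rewrite mulrAC conductance_cross.
rewrite -!mulrA; congr (_ * _). lra.
Qed.

Lemma taboo_lim_ge0 i : 0 <= taboo_lim i.
Proof. by apply: limr_ge; [exact: taboo_cvg|apply: nearW => n; exact: taboo_ge0]. Qed.

Lemma taboo_lim_le1 i : taboo_lim i <= 1.
Proof. by apply: limr_le; [exact: taboo_cvg|apply: nearW => n; exact: taboo_le1]. Qed.

Lemma taboo_lim_eq0 : ~ bounded_sums (fun i => (c i)^-1) -> taboo_lim j = 0.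
Proof.
move=> unb.
have hj : h j = 0 by rewrite /h eqxx.
have h0 i : 0 <= h i by rewrite /h; case: ifP => // _; exact: taboo_lim_ge0.
have h1 i : h i <= 1 by rewrite /h; case: ifP => // _; exact: taboo_lim_le1.
have hup : h j.+1 = 0.
  apply/eqP; rewrite eq_le h0 andbT leNgt; apply/negP => hpos.
  (* The constant flow above [j] is [c j.+1 * h j.+1], and [1 - h] is nonnegative and descends at
     that rate. *)
  apply: unb; apply: (@bounded_sums_of_descent (fun i => 1 - h i) j (c j.+1 * h j.+1)).
  - by rewrite mulr_gt0 // conductance_gt0.
  - by move=> i _; rewrite subr_ge0.
  - move=> i ji; rewrite -(subnKC ji); elim: (i - j)%N => [|k IH].
      by rewrite addn0 hj; lra.
    have := @taboo_lim_flow (j + k)%N; rewrite !addnS gtn_eqF ?leq_addr //.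
    by move=> /(_ isT); move: IH; rewrite !mulrBr; lra.
(* The self loop at 0 carries no flow, so [h] is constant from 0 up to [j], where it vanishes. *)
have hflat i : (i < j)%N -> h i.+1 = h i.
  elim: i => [|i IH] ij.
    have := taboo_lim_rec 0; rewrite /= -{1}(mul1r (taboo_lim _)) -(pq1 0).
    have -> : taboo_lim 0 = h 0%N by rewrite /h ltn_eqF.
    move=> E; apply/eqP; rewrite eq_sym; apply/eqP.
    apply: (mulfI (lt0r_neq0 (p_gt0 0))); lra.
  have := @taboo_lim_flow i; rewrite ltn_eqF // => /(_ isT).
  rewrite (IH (ltnW ij)) subrr mulr0 => /eqP.
  by rewrite mulf_eq0 gt_eqF ?conductance_gt0 //= subr_eq0 => /eqP ->.
have hdown : h j.-1 = 0.
  by have [j0|j0] := posnP j; [have -> : j.-1 = j by rewrite j0|rewrite -hflat ?prednK].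
by rewrite taboo_lim_rec hup hdown !mulr0 addr0.
Qed.

(** The mean of [min(T, N)], where [T] is the first positive time at [j], written as a sum of tail
    probabilities. *)
Definition taboo_sum (N i : nat) : R := \sum_(n < N) taboo j n i.

Lemma taboo_sumS N i : taboo_sum N.+1 i =
  1 + p i * (if i.+1 == j then 0 else taboo_sum N i.+1)
    + q i * (if i.-1 == j then 0 else taboo_sum N i.-1).
Proof.
rewrite /taboo_sum big_ord_recl /= big_split /= -!mulr_sumr addrA.
by congr (_ + _ * _ + _ * _); case: ifP => // _; rewrite big1.
Qed.

Lemma taboo_sum_ge0 N i : 0 <= taboo_sum N i.
Proof. by apply: sumr_ge0 => n _; exact: taboo_ge0. Qed.

(** From [i >= j] the walk steps up, away from [j], with probability [p i > 0], so finiteness of the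
    mean at [i] passes to [i.+1] at the cost of a factor [1 / p i]. *)
Lemma bounded_sums_taboo_up i : bounded_sums (fun n => taboo j n j) ->
  (j <= i)%N -> bounded_sums (fun n => taboo j n i).
Proof.
move=> bj ji; rewrite -(subnKC ji); elim: (i - j)%N => [|k [B IH]].
  by rewrite addn0.
exists (B / p (j + k)) => N; rewrite ler_pdivlMr // mulrC.
have := IH N.+1; rewrite -/(taboo_sum N.+1 _) taboo_sumS addnS gtn_eqF ?ltnS ?leq_addr //.
apply: le_trans; rewrite addrAC addrC lerDl addr_ge0 // mulr_ge0 ?(ltW (q_gt0 _)) //.
by case: ifP => // _; exact: taboo_sum_ge0.
Qed.

Lemma taboo_sum_unbounded :
  ~ bounded_sums c -> ~ bounded_sums (fun i => (c i)^-1) ->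
  ~ bounded_sums (fun n => taboo j n j).
Proof.
move=> unbc unbr bj.
pose W i := limn (fun N => taboo_sum N i).
have Wcvg i : (j <= i)%N -> (fun N => taboo_sum N i) @ \oo --> W i.
  move=> ji; apply: nondecreasing_is_cvgn.
    by apply/nondecreasing_seqP => N; rewrite /taboo_sum big_ord_recr /= lerDl taboo_ge0.
  by have [B WB] := bounded_sums_taboo_up bj ji; exists B => _ [N _ <-]; exact: WB.
(* [W j] is the mean return time, whereas the hitting time of [j] from [j] is 0. *)
pose H i := if i == j then 0 else W i.
have H0 i : (j <= i)%N -> 0 <= H i.
  move=> ji; rewrite /H; case: ifP => // _; apply: limr_ge; first exact: Wcvg.
  by apply: nearW => N; exact: taboo_sum_ge0.
have Hrec i : (j < i)%N -> H i = 1 + p i * H i.+1 + q i * H i.-1.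
  move=> ji; rewrite {1}/H gtn_eqF //.
  have H1 : (fun N => taboo_sum N.+1 i) @ \oo --> W i.
    by have := Wcvg i (ltnW ji); rewrite -cvg_shiftS.
  have H2 : (fun N => taboo_sum N.+1 i) @ \oo --> 1 + p i * H i.+1 + q i * H i.-1.
    under eq_fun do rewrite taboo_sumS.
    have up : (j <= i.+1)%N by rewrite ltnW // ltnW.
    have down : (j <= i.-1)%N by case: i ji {H1 up}.
    by apply: cvgD; [apply: cvgD|]; try apply: cvgM; (try exact: cvg_cst);
      apply: cvg_off; exact: Wcvg.
  exact: cvg_unique H1 H2.
(* The exact drop at vertex [i] is [c i / q i = c i + c i.+1]; retaining [c i] suffices. *)
have flow k : c (j + k).+1 * (H (j + k).+1 - H (j + k)%N)
    <= c j.+1 * (H j.+1 - H j) - \sum_(l < k) c (j.+1 + l)%N.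
  elim: k => [|k IH]; first by rewrite addn0 big_ord0 subr0.
  rewrite big_ord_recr /= opprD addrA addnS addSn.
  apply: (le_trans _ (lerD IH (lexx _))).
  have := Hrec (j + k).+1; rewrite ltnS leq_addr => /(_ isT) /=.
  have q0 := q_gt0 (j + k).+1; have c0 := conductance_gt0 (j + k).+1.
  have E := conductance_cross (j + k).+1; have p0 := p_gt0 (j + k).+1.
  have E1 := pq1 (j + k).+1.
  move=> EH; rewrite -(ler_pM2r q0) mulrAC E.
  set P := p _ in EH E1 p0 *; set Q := q _ in EH E1 q0 *.
  set a := H (j + k).+2 in EH *; set b := H (j + k).+1 in EH *.
  set d := H (j + k)%N in EH *.
  have F : P * (a - b) = Q * (b - d) - 1.
    by rewrite (_ : b = (P + Q) * b) in EH; [lra|rewrite E1 mul1r].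
  rewrite -mulrA F; set C := c _ in c0 *.
  (* The slack is the discarded [c i.+1], multiplied by [q i] and so equal to [c i * p i]. *)
  rewrite -subr_ge0 (_ : _ - _ = C * P); last by rewrite -[P](addrK Q) E1; ring.
  by rewrite mulr_ge0 // ltW.
(* The divergent sum of conductances eventually outweighs the initial flow; from then on the
   nonnegative [H] descends with [e = 1]. *)
have [K HK] : exists K, c j.+1 * (H j.+1 - H j) - \sum_(l < K) c (j.+1 + l)%N <= -1.
  apply: contrapT => /forallNP no; apply: unbc.
  apply: (@bounded_sums_shift _ _ j.+1) => [i|]; first by rewrite ltW ?conductance_gt0.
  exists (c j.+1 * (H j.+1 - H j) + 1) => n.
  by have := no n; move/negP; rewrite -ltNge; lra.
apply: unbr; apply: (@bounded_sums_of_descent H (j + K) 1) => //.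
  by move=> i /(leq_trans (leq_addr _ _)); exact: H0.
move=> i ji; rewrite -(subnKC ji) -addnA; apply: (le_trans (flow _)).
apply: le_trans HK; rewrite lerD2l lerN2 big_split_ord /= lerDl sumr_ge0 // => l _.
by rewrite ltW ?conductance_gt0.
Qed.

End Excursions.
End BirthDeath.

(** * Path probabilities and return times of the Markov chain *)

Section MarkovChain.
Variables (R : realType) (p q : nat -> R).
Hypotheses (p_gt0 : forall i, 0 < p i) (q_gt0 : forall i, 0 < q i).
Hypothesis pq1 : forall i, p i + q i = 1.
Variables (d : measure_display) (T : measurableType d).
Variables (Pr : nat -> probability T R) (X : nat -> {mfun T >-> nat}).
Hypothesis X_markov : markov_chain (transition p q) Pr X.

Lemma measurable_hit n (A : set nat) : measurable (X n @^-1` A).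
Proof. exact: measurable_funPTI. Qed.

Lemma measurable_cylinder n x : measurable (cylinder X n x).
Proof.
rewrite (_ : cylinder X n x = \bigcap_(k in [set k | (k <= n)%N]) (X k @^-1` [set x k])).
  by apply: bigcap_measurable => [|k _]; [exists 0%N|exact: measurable_hit].
by apply/seteqP; split => w H k /H.
Qed.

(** Time [m] is excluded, so that a start at [j] is not itself a return. *)
Definition avoid (j m n : nat) : set T :=
  [set w | forall k, (m < k <= m + n)%N -> X k w <> j].

Lemma measurable_avoid j m n : measurable (avoid j m n).
Proof.
rewrite (_ : avoid j m n =
    \bigcap_(k in [set k | (m < k <= m + n)%N]) (X k @^-1` (~` [set j]))).
  apply: bigcap_measurableType => k _; exact: measurable_hit.
by apply/seteqP; split => w H k /H.
Qed.

Definition extend_path (m : nat) (x : nat -> nat) (k : nat) : nat -> nat :=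
  fun l => if l == m.+1 then k else x l.

Lemma cylinder_extend m x k :
  cylinder X m.+1 (extend_path m x k) = cylinder X m x `&` X m.+1 @^-1` [set k].
Proof.
apply/seteqP; split => w /=.
  move=> H; split; last by rewrite /= H // /extend_path eqxx.
  by move=> l lm; rewrite H ?(leqW lm) // /extend_path ltn_eqF.
move=> [H Hk] l; rewrite leq_eqVlt => /predU1P[->|lm].
  by rewrite /extend_path eqxx.
by rewrite H // /extend_path ltn_eqF.
Qed.

Lemma prob_cylinder_next i m x k :
  (Pr i (cylinder X m x `&` X m.+1 @^-1` [set k])
   = Pr i (cylinder X m x) * (transition p q (x m) k)%:E)%E.
Proof.
rewrite -cylinder_extend (X_markov i).2 {2 3}/extend_path eqxx ltn_eqF //.
congr (Pr i _ * _)%E; apply/seteqP.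
by split => w H l lm; have := H l lm; rewrite /extend_path /= ltn_eqF.
Qed.

(* The two listed continuations of a cylinder already exhaust its mass, because
   p + q = 1, so no summation over all the states is needed. *)
Lemma prob_cylinder_step i m x (E : set T) : measurable E ->
  E `<=` cylinder X m x ->
  (Pr i E = Pr i (E `&` X m.+1 @^-1` [set (x m).+1])
            + Pr i (E `&` X m.+1 @^-1` [set (x m).-1]))%E.
Proof.
move=> mE EC; set A := X m.+1 @^-1` _; set B := X m.+1 @^-1` _.
have mA : measurable A := measurable_hit _ _.
have mB : measurable B := measurable_hit _ _.
have AB : A `&` B = set0.
  by apply/seteqP; split => // w [/=]; rewrite /A /B /= => ->; lia.
have split F : measurable F ->
    (Pr i F = Pr i (F `&` A) + (Pr i (F `&` B) + Pr i (F `\` (A `|` B))))%E.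
  move=> mF; rewrite -measureU; last first.
  - by apply/seteqP; split => // w [[_ Bw] [_ /=]]; tauto.
  - by apply: measurableD => //; exact: measurableU.
  - exact: measurableI.
  rewrite -measureU; first last.
  - apply/seteqP; split => // w [[_ Aw] [[_ Bw]|[_ /=]]]; last by tauto.
    by have : (A `&` B) w by []; rewrite AB.
  - apply: measurableU; first exact: measurableI.
    by apply: measurableD => //; exact: measurableU.
  - exact: measurableI.
  congr (Pr i _); apply/seteqP; split => w /=; last by tauto.
  by move=> Fw; have [|] := pselect (A w); have [|] := pselect (B w); tauto.
have PA : (Pr i (cylinder X m x `&` A) = Pr i (cylinder X m x) * (p (x m))%:E)%E.
  by rewrite prob_cylinder_next /transition eqxx.
have PB : (Pr i (cylinder X m x `&` B) = Pr i (cylinder X m x) * (q (x m))%:E)%E.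
  by rewrite prob_cylinder_next /transition ltn_eqF ?eqxx //; lia.
have rest : Pr i (cylinder X m x `\` (A `|` B)) = 0%E.
  have := split _ (measurable_cylinder m x); rewrite PA PB.
  have mD : measurable (cylinder X m x `\` (A `|` B)).
    by apply: measurableD; [exact: measurable_cylinder|exact: measurableU].
  rewrite -(fineK (fin_num_measure (Pr i) _ (measurable_cylinder m x))).
  rewrite -(fineK (fin_num_measure (Pr i) _ mD)) -!EFinM -!EFinD.
  move=> [] E1; congr EFin; move: E1; set a := fine _; set b := fine _.
  by have := pq1 (x m) => e1 e2; have : a = a * (p (x m) + q (x m)) + b;
    [rewrite mulrDr; lra|rewrite e1; lra].
rewrite {1}(split _ mE) addeA (_ : Pr i (E `\` (A `|` B)) = 0%E) ?adde0 //.
apply/eqP; rewrite eq_le measure_ge0 andbT -rest le_measure ?inE //.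
- by apply: measurableD => //; exact: measurableU.
- by apply: measurableD; [exact: measurable_cylinder|exact: measurableU].
- by move=> w [/EC].
Qed.

(** First-step analysis: a step to [j] contributes nothing, and a step to another [k] extends the
    cylinder to time [m.+1] with [n] steps left. The induction on [n] therefore keeps [m] and [x]
    free. *)
Lemma prob_cylinder_avoid i j n m x :
  (Pr i (cylinder X m x `&` avoid j m n)
   = Pr i (cylinder X m x) * (taboo p q j n (x m))%:E)%E.
Proof.
elim: n m x => [|n IH] m x.
  rewrite mule1; congr (Pr i _); apply/seteqP; split => w; first by case.
  by move=> cw; split => // k; lia.
rewrite (@prob_cylinder_step i m x); last 2 first.
- by apply: measurableI; [exact: measurable_cylinder|exact: measurable_avoid].
- by move=> w [].
have step k : (Pr i (cylinder X m x `&` avoid j m n.+1 `&` X m.+1 @^-1` [set k])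
   = Pr i (cylinder X m x) * (transition p q (x m) k
       * (if k == j then 0 else taboo p q j n k))%:E)%E.
  have [->|kj] := eqVneq k j.
    rewrite mulr0 mule0 -(measure0 (Pr i)); congr (Pr i _).
    apply/seteqP; split => // w [[_ Aw] /= Xj].
    by apply: (Aw m.+1) => //; lia.
  transitivity (Pr i (cylinder X m.+1 (extend_path m x k) `&` avoid j m.+1 n)).
    rewrite cylinder_extend; congr (Pr i _); apply/seteqP; split => w.
      by move=> [[Cw Aw] Xk]; split => // l lm; apply: Aw; lia.
    move=> [[Cw Xk] Aw]; split => //; split => // l lm.
    have [->|lm1] := eqVneq l m.+1; first by rewrite Xk; exact/eqP.
    by apply: Aw; lia.
  rewrite IH cylinder_extend prob_cylinder_next {1}/extend_path eqxx EFinM.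
  by rewrite muleA.
rewrite !step -muleDr ?fin_num_measure //; last exact: measurable_cylinder.
by rewrite -EFinD /transition eqxx ltn_eqF ?eqxx //; lia.
Qed.

Lemma prob_avoid j n : Pr j (avoid j 0 n) = (taboo p q j n j)%:E.
Proof.
have H := @prob_cylinder_avoid j j n 0%N (fun=> j).
have cyl0 : cylinder X 0 (fun=> j) = X 0%N @^-1` [set j].
  by apply/seteqP; split => w /=; [exact|move=> H0 [|]].
have P1 : Pr j (cylinder X 0 (fun=> j)) = 1%E by rewrite cyl0 (X_markov j).1.
rewrite P1 mul1e in H; rewrite -H.
have mC := measurable_cylinder 0 (fun=> j).
have mA := measurable_avoid j 0 n.
(* The start at [j] is almost sure, so intersecting with its cylinder loses no mass. *)
rewrite (measureDI (Pr j) mA mC) setIC -[RHS]add0e; congr (_ + _)%E.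
apply/eqP; rewrite eq_le measure_ge0 andbT.
apply: (@le_trans _ _ (Pr j (~` cylinder X 0 (fun=> j)))).
  by apply: le_measure; rewrite ?inE; [exact: measurableD|exact: measurableC|move=> w []].
by rewrite probability_setC // P1 subee.
Qed.

Lemma return_time_ge0 j w : (0 <= return_time R (fun n => X n) j w)%E.
Proof. by apply: le_ereal_inf_tmp => _ [n _ <-]; rewrite lee_fin. Qed.

Lemma return_time_lt_pinfty j w :
  (return_time R (fun n => X n) j w < +oo)%E <-> exists n, (0 < n)%N /\ X n w = j.
Proof.
split => [|[n Hn]]; last first.
  apply: le_lt_trans (ltry n%:R); apply: ereal_inf_lbound; by exists n.
apply: contraPP => no; rewrite /return_time.
rewrite (_ : [set n | _] = set0) ?image_set0 ?ereal_inf0 ?ltxx //.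
by apply/seteqP; split => // n /= Hn; apply: no; exists n.
Qed.

(** Never returning lies inside every [avoid j 0 n], and the probabilities of these events tend to
    0. *)
Lemma prob_return j : limn (fun n => taboo p q j n j) = 0 ->
  Pr j [set w | (return_time R (fun n => X n) j w < +oo)%E] = 1%E.
Proof.
move=> lim0.
set F := [set w | _].
have FE : F = ~` (\bigcap_n avoid j 0 n).
  apply/seteqP; split => w.
    move/return_time_lt_pinfty => [n [n0 Xn]] /(_ n I) /(_ n); rewrite n0 leqnn.
    by move/(_ isT).
  move=> H; apply/return_time_lt_pinfty; apply: contrapT => no; apply: H.
  move=> n _ k /andP[k0 _] Xk.
  by apply: no; exists k.
have mA : measurable (\bigcap_n avoid j 0 n).
  by apply: bigcap_measurable => // n _; exact: measurable_avoid.
rewrite FE probability_setC // (_ : Pr j _ = 0%E) ?sube0 //.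
apply/eqP; rewrite eq_le measure_ge0 andbT.
rewrite -(fineK (fin_num_measure (Pr j) _ mA)) lee_fin -lim0.
apply: limr_ge; first exact: (taboo_cvg p_gt0 q_gt0 pq1 (j := j) (i := j)).
apply: nearW => n; rewrite -lee_fin fineK ?fin_num_measure // -prob_avoid.
apply: le_measure; rewrite ?inE //; first exact: measurable_avoid.
by move=> w; apply.
Qed.

(** A pointwise tail-sum bound: [avoid j 0 n] forces the return time to exceed [n], so the first [N]
    indicators add up to at most the return time. *)
Lemma expected_return_ge j N :
  ((\sum_(n < N) taboo p q j n j)%:E <= \int[Pr j]_w return_time R (fun n => X n) j w)%E.
Proof.
have -> : (\sum_(n < N) taboo p q j n j)%:E
   = (\int[Pr j]_w (\sum_(n < N) (\1_(avoid j 0 n) w)%:E))%E.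
  rewrite ge0_integral_sum //; last first.
    move=> n; apply/measurable_EFinP; apply: measurable_indic.
    exact: measurable_avoid.
  rewrite -sumEFin; apply: eq_bigr => n _; rewrite integral_indic ?setIT //.
    exact/esym/prob_avoid.
  exact: measurable_avoid.
(* [ge0_le_integral] would also need the return time to be measurable. *)
rewrite ge0_integralTE; last by move=> w; apply: sume_ge0 => n _; rewrite lee_fin.
rewrite ge0_integralTE; last by move=> w; exact: return_time_ge0.
apply: le_ereal_sup => _ [h hle <-]; exists h => // w.
apply: (le_trans (hle w)).
apply: le_ereal_inf_tmp => _ [m [m0 Xm] <-]; rewrite sumEFin lee_fin.
have bound (n : nat) : (\1_(avoid j 0 n) w : R) <= (n < m)%:R.
  rewrite indicE; case: (boolP (w \in _)) => [|_]; last by rewrite ler0n.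
  rewrite inE => /= Aw; have [//|mn] := ltnP n m.
  by case: (Aw m); rewrite // m0.
apply: (@le_trans _ _ (\sum_(n < N) (n < m)%:R)); first exact: ler_sum.
rewrite -natr_sum ler_nat.
suff H M : (\sum_(n < M) (n < m) <= minn M m)%N by apply: leq_trans (H N) (geq_minr _ _).
elim: M => [|M IH]; first by rewrite big_ord0.
rewrite big_ord_recr /=; move: IH; move: (\sum_(n < M) _)%N => S.
by case: (ltnP M m) => [/minn_idPl|]; lia.
Qed.

Lemma null_recurrent_birth_death :
  ~ bounded_sums (conductance p q) ->
  ~ bounded_sums (fun i => (conductance p q i)^-1) ->
  null_recurrent Pr (fun n => X n).
Proof.
move=> unbc unbr j; split.
  by apply: prob_return; exact: taboo_lim_eq0.
have := taboo_sum_unbounded p_gt0 q_gt0 pq1 (j := j) unbc unbr.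
have : (0 <= \int[Pr j]_w return_time R (fun n => X n) j w)%E.
  by apply: integral_ge0 => w _; exact: return_time_ge0.
have := expected_return_ge j.
(* A finite value would bound all the taboo sums, and nonnegativity excludes [-oo]. *)
move: (\int[Pr j]_w return_time R (fun n => X n) j w)%E => [r| |] // le_r _ [].
by exists r => N; rewrite -lee_fin.
Qed.

End MarkovChain.

(** * Eigenvectors built from shift-invariant edge flows *)

Section Eigenvector.
Variables (R : realType) (C : nat -> 'M[R[i]]_2).

Lemma sqmod_ge0 (z : R[i]) : 0 <= sqmod z.
Proof. exact: sqr_ge0. Qed.

Lemma sqmodM (x y : R[i]) : sqmod (x * y) = sqmod x * sqmod y.
Proof. by rewrite /sqmod Normc.normcM exprMn. Qed.

Lemma sqmodV (x : R[i]) : sqmod x^-1 = (sqmod x)^-1.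
Proof. by rewrite /sqmod Normc.normcV exprVn. Qed.

Lemma sqmod1 : sqmod (1 : R[i]) = 1.
Proof. by rewrite /sqmod Normc.normc1 expr1n. Qed.

Lemma sqmod_eq0 (z : R[i]) : (sqmod z == 0) = (z == 0).
Proof.
rewrite /sqmod sqrf_eq0; apply/eqP/eqP => [/Normc.eq0_normc//|->].
exact: Normc.normc0.
Qed.

Lemma sqmodC (z : R[i]) : sqmod z^* = sqmod z.
Proof. by case: z => a b; rewrite /sqmod /= sqrrN. Qed.

Lemma sqmodN (z : R[i]) : sqmod (- z) = sqmod z.
Proof. by rewrite /sqmod normcN. Qed.

(* The arc functions fixed by the shift: one amplitude per unoriented edge,
   with y 0 on the self loop and y j.+1 on the edge {j, j+1}. *)
Definition edge_flow (y : nat -> R[i]) : Defs.arc -> R[i] :=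
  fun a => if a.2 == dR then y a.1.+1 else y a.1.

(** Each edge amplitude is read by at most two arcs, so the bound at most doubles. *)
Lemma edge_flow_ell2 (y : nat -> R[i]) :
  bounded_sums (fun j => sqmod (y j)) -> ell2 (edge_flow y).
Proof.
move=> [B yB]; rewrite /ell2.
have -> : [set: Defs.arc] = [set: nat] `*`` (fun=> [set: 'I_2]) by apply/seteqP; split.
rewrite -(@esum_esum _ _ _ _ _ (fun j e => (sqmod (edge_flow y (j, e)))%:E)); last first.
  by move=> *; rewrite lee_fin sqmod_ge0.
have E j : (\esum_(e in [set: 'I_2]) (sqmod (edge_flow y (j, e)))%:E)%E
    = (sqmod (y j.+1) + sqmod (y j))%:E.
  rewrite esum_fset; [|exact: finite_finset|by move=> *; rewrite lee_fin sqmod_ge0].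
  have -> : [set: 'I_2] = [set dR] `|` [set dL].
    apply/seteqP; split => // -[[|[|//]]] l _; [left|right]; exact/val_inj.
  by rewrite fsbigU0 ?fsbig_set1 // => e [-> ].
rewrite (eq_esum (fun j _ => E j)).
rewrite -nneseries_esumT; last by move=> *; rewrite lee_fin addr_ge0 ?sqmod_ge0.
apply: (@le_lt_trans _ _ (B + B)%:E); last exact: ltry.
apply: lime_le.
  by apply: is_cvg_nneseries => *; rewrite lee_fin addr_ge0 ?sqmod_ge0.
apply: nearW => n; rewrite sumEFin lee_fin big_mkord big_split /=.
apply: lerD; last exact: yB.
apply: le_trans (yB n.+1); rewrite big_ord_recl /= lerDr sqmod_ge0 //.
Qed.

(** Multiplying the amplitude by [v j 0 dR / v j 0 dL] across each vertex [j] makes every fibre of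
    the edge flow a multiple of [v j]. The coin then acts as [s], and the shift fixes the flow. *)
Lemma eigenvector_of_ratio (s : R[i]) (v : nat -> 'rV[R[i]]_2) (r : nat -> R) :
  (forall j, v j *m C j = s *: v j) -> (forall j, v j 0 dL != 0) ->
  (forall j, sqmod (v j 0 dR) = r j * sqmod (v j 0 dL)) ->
  bounded_sums (fun n => \prod_(k < n) r k) ->
  point_spectrum (walk_op C) s.
Proof.
move=> vC vL vr br.
pose y n := \prod_(k < n) (v k 0 dR / v k 0 dL).
have yS n : y n.+1 = y n * (v n 0 dR / v n 0 dL) by rewrite /y big_ord_recr.
have y2 n : sqmod (y n) = \prod_(k < n) r k.
  elim: n => [|n IH]; first by rewrite /y !big_ord0 sqmod1.
  rewrite yS big_ord_recr /= sqmodM IH sqmodM sqmodV vr mulfK //.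
  by rewrite sqmod_eq0.
exists (edge_flow y); split.
- apply: edge_flow_ell2; case: br => B yB; exists B => n.
  by under eq_bigr do rewrite y2; exact: yB.
- by exists (0%N, dL); rewrite /edge_flow /= /y big_ord0 oner_eq0.
have fib j : fibre (edge_flow y) j = (y j / v j 0 dL) *: v j.
  apply/rowP => e; rewrite !mxE /edge_flow /=.
  have [->|] := eqVneq e dR; first by rewrite yS mulrA mulrAC.
  by case: e => [[|[|]]] // ? _; rewrite (_ : Ordinal _ = dL) ?divfK //; apply/val_inj.
have coin a : coin_op C (edge_flow y) a = s * edge_flow y a.
  rewrite /coin_op fib -scalemxAl vC scalerA mulrC -scalerA -fib !mxE.
  by case: a.
have inv a : edge_flow y (arc_inv a) = edge_flow y a.
  case: a => [j e]; rewrite /arc_inv /edge_flow /=.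
  by have [//|_] := eqVneq e dR; case: j.
by move=> a; rewrite /walk_op /shift_op coin inv.
Qed.

Lemma sum_dR_dL (V : nmodType) (f : 'I_2 -> V) : \sum_e f e = f dR + f dL.
Proof.
by rewrite big_ord_recl big_ord1; congr (_ + f _); apply/val_inj.
Qed.

(** Unitarity preserves the pairing of [v] with [u], while the eigenvalue equations multiply it by
    [s2 * s1^*]. Since [s1] is unimodular, this factor is 1 only if [s2 = s1]. *)
Lemma unitary_eigen_orthogonal n (M : 'M[R[i]]_n) (s1 s2 : R[i]) (u v : 'rV_n) :
  M \is unitarymx -> `|s1| = 1 -> s1 != s2 ->
  u *m M = s1 *: u -> v *m M = s2 *: v -> v *m (u ^t*)%sesqui = 0.
Proof.
move=> /unitarymxP MU s1u ns uM vM.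
have : (v *m M) *m ((u *m M) ^t*)%sesqui = v *m (u ^t*)%sesqui.
  by rewrite trmx_mul map_mxM mulmxA -(mulmxA v) MU mulmx1.
rewrite uM vM linearZ /= map_mxZ -scalemxAl -scalemxAr scalerA => E.
have : (s2 * s1^* - 1) *: (v *m (u ^t*)%sesqui) = 0 by rewrite scalerBl E scale1r subrr.
move/eqP; rewrite scaler_eq0 => /orP[|/eqP//].
rewrite subr_eq0 => /eqP E1.
have : s1 * s1^* = 1 by rewrite -sqr_normc s1u expr1n.
move=> E2; case/eqP: ns; by rewrite -[s2]mulr1 -E2 mulrCA E1 mulr1.
Qed.

End Eigenvector.

(** * Choice of the eigenvalue by the convergent series *)

Theorem theorem1p1 (R : realType)
  (C : nat -> 'M[R[i]]_2) (s1 s2 : R[i])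
  (C_unitary : forall j, C j \is unitarymx)
  (s1_unimodular : `|s1| = 1) (s2_unimodular : `|s2| = 1)
  (s1_neq_s2 : s1 != s2)
  (C_spec : forall j, [set z | eigenvalue (C j) z] = [set s1; s2])
  (C_dim : forall j, \rank (eigenspace (C j) s1) = 1%N)
  (alpha : nat -> 'rV[R[i]]_2)
  (alpha_unit : forall j, \sum_(e < 2) sqmod (alpha j 0 e) = 1)
  (alpha_span : forall j, (alpha j == eigenspace (C j) s1)%MS)
  (p q : nat -> R)
  (p_def : forall j, p j = sqmod (alpha j 0 dR))
  (q_def : forall j, q j = sqmod (alpha j 0 dL))
  (p_gt0 : forall j, 0 < p j) (q_gt0 : forall j, 0 < q j)
  (d : measure_display) (T : measurableType d)
  (Pr : nat -> probability T R) (X : nat -> {mfun T >-> nat})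
  (X_markov : markov_chain (transition p q) Pr X)
  (X_not_null : ~ null_recurrent Pr (fun n => X n)) :
  point_spectrum (walk_op C) !=set0.
Proof.
have pq1 j : p j + q j = 1 by rewrite p_def q_def -(alpha_unit j) sum_dR_dL.
have alphaC j : alpha j *m C j = s1 *: alpha j.
  by apply/eigenspaceP; case/andP: (alpha_span j).
have alphaR j : alpha j 0 dR != 0 by rewrite -sqmod_eq0 -p_def gt_eqF.
have alphaL j : alpha j 0 dL != 0 by rewrite -sqmod_eq0 -q_def gt_eqF.
have [bc|unbc] := pselect (bounded_sums (conductance p q)).
  exists s1; apply: (@eigenvector_of_ratio _ _ _ alpha (fun k => p k / q k)) => // j.
  by rewrite -p_def -q_def divfK // gt_eqF.
have [br|unbr] := pselect (bounded_sums (fun i => (conductance p q i)^-1)); last first.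
  by case: X_not_null; exact: (null_recurrent_birth_death p_gt0 q_gt0 pq1 X_markov).
have ev2 j : eigenvalue (C j) s2.
  suff : [set z | eigenvalue (C j) z] s2 by [].
  by rewrite C_spec; right.
have /choice[v vP] j : exists v : 'rV_2, v *m C j = s2 *: v /\ v != 0.
  by have /eigenvalueP[v] := ev2 j; exists v.
have orth j : v j 0 dR * (alpha j 0 dR)^* + v j 0 dL * (alpha j 0 dL)^* = 0.
  have /matrixP/(_ 0 0) := unitary_eigen_orthogonal (C_unitary j) s1_unimodular
    s1_neq_s2 (alphaC j) (vP j).1.
  by rewrite !mxE sum_dR_dL !mxE.
(* Otherwise orthogonality to [alpha j], whose [dR] entry is nonzero, would give [v j = 0]. *)
have vL j : v j 0 dL != 0.
  apply: contra_neq (vP j).2 => vL0.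
  have := orth j; rewrite vL0 mul0r addr0 => /eqP.
  rewrite mulf_eq0 conjC_eq0 (negbTE (alphaR j)) orbF => /eqP vR0.
  apply/rowP => e; rewrite mxE.
  by case: e => [[|[|//]]] l; [rewrite -[RHS]vR0|rewrite -[RHS]vL0];
    congr (v j _ _); exact/val_inj.
exists s2; apply: (@eigenvector_of_ratio _ _ _ v (fun k => (p k / q k)^-1)) => // [j|j|].
- exact: (vP j).1.
(* Orthogonality in dimension two swaps the weights: [sqmod (v j 0 dR) * p j = sqmod (v j 0 dL) * q
   j]. *)
- have /eqP := orth j; rewrite addr_eq0 => /eqP /(congr1 (@sqmod R)).
  rewrite sqmodN !sqmodM !sqmodC -p_def -q_def => E.
  apply: (mulIf (lt0r_neq0 (p_gt0 j))); rewrite E invf_div.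
  by rewrite [RHS]mulrAC divfK ?gt_eqF // mulrC.
- case: br => B cB; exists B => n; apply: le_trans (cB n).
  by apply: ler_sum => i _; rewrite /conductance prodfV.
Qed.
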